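(* Let $p\in C^4(a,b)$ be real-valued, let $q$ be a real constant (so $q'=0$), and let $f:(a,b)\to\mathbb{R}$ be a solution of $f''+pf'+qf=0$. Put $$v=(f')^2-f''f,\qquad w=\det\begin{pmatrix} f'' & f' & f\\ f^{(3)} & f'' & f'\\ f^{(4)} & f^{(3)} & f''\end{pmatrix}.$$ Then at every $x\in(a,b)$ with $p'(x)\neq 0$ the identity $$w'+\frac32\left(p-\frac{p''}{p'}\right)w=p'\cdot f'\cdot V$$ holds, where $$V:=\left(\frac12\left(p'p-p''\right)f+p'f'\right)f'-\left(\frac12p^2-p'-2q+\frac{p'''}{p'}-\frac32\frac{(p'')^2}{(p')^2}\right)v.$$
   Context: Primes and superscripts $(k)$ denote derivatives with respect to the variable $x$. *)

(* Defs.v *)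
From mathcomp Require Export all_boot all_order all_algebra.
From mathcomp Require Export all_classical all_reals all_analysis.

Set Implicit Arguments.
Unset Strict Implicit.
Unset Printing Implicit Defensive.

Import Order.TTheory GRing.Theory Num.Theory.
Import numFieldNormedType.Exports.

Local Open Scope classical_set_scope.
Local Open Scope ring_scope.

(* Arguments of ring operations are parsed in ring_scope, where these notations
   otherwise denote formal derivatives of polynomials. *)
Notation "f ^` ()" := (derive1 f) : ring_scope.
Notation "f ^` ( n )" := (derive1n n f) : ring_scope.

(* The endpoints are extended reals, so that unbounded open intervals are
   included; functions on ooint a b are total functions R -> R of which only
   the values on ooint a b matter. *)
Definition ooint (R : realType) (a b : \bar R) : set R :=
  [set x | (a < x%:E)%E /\ (x%:E < b)%E].

Definition derivable_n (R : realType) (n : nat) (D : set R) (f : R -> R) :=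
  forall k x, (k < n)%N -> D x -> derivable f^`(k) x 1.

Definition class_C (R : realType) (n : nat) (D : set R) (f : R -> R) :=
  derivable_n n D f /\ (forall x, D x -> {for x, continuous f^`(n)}).

Definition is_solution (R : realType) (D : set R) (p : R -> R) (q : R)
    (f : R -> R) :=
  derivable_n 2 D f /\
  (forall x, D x -> f^`(2) x + p x * f^`() x + q * f x = 0).

Definition vfun (R : realType) (f : R -> R) (x : R) : R :=
  f^`() x ^+ 2 - f^`(2) x * f x.

(* The (i, j) entry, i, j in {0, 1, 2}, is the derivative of f of order
   2 + i - j. *)
Definition wmx (R : realType) (f : R -> R) (x : R) : 'M[R]_3 :=
  \matrix_(i < 3, j < 3) f^`((2 + i - j)%N) x.

Definition wfun (R : realType) (f : R -> R) (x : R) : R := \det (wmx f x).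

Definition Vfun (R : realType) (p : R -> R) (q : R) (f : R -> R) (x : R) : R :=
  (2^-1 * (p^`() x * p x - p^`(2) x) * f x + p^`() x * f^`() x) * f^`() x
  - (2^-1 * p x ^+ 2 - p^`() x - 2 * q + p^`(3) x / p^`() x
     - 3 / 2 * (p^`(2) x ^+ 2 / p^`() x ^+ 2)) * vfun f x.

(* Main.v *)
(* Differentiating f'' = - p f' - q f repeatedly expresses f^(3), f^(4) and
   f^(5) through f, f' and p, ..., p^(3); after these substitutions the claim is
   an identity between rational functions. *)
Require Import Defs.
From mathcomp Require Import ring.

Set Implicit Arguments.
Unset Strict Implicit.
Unset Printing Implicit Defensive.

Import Order.TTheory GRing.Theory Num.Theory.
Import numFieldNormedType.Exports.
Local Open Scope classical_set_scope.
Local Open Scope ring_scope.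

Lemma open_ooint (R : realType) (a b : \bar R) : open (ooint a b).
Proof.
by apply: (@openI _ [set x : R | a < x%:E]%E [set x : R | x%:E < b]%E);
  [exact: open_ereal_gt | exact: open_ereal_lt].
Qed.

(** An open [D] is a neighbourhood of each of its points, so [f] and [g] agree near [x]. This
    permits differentiating formulas that hold only on [D]. *)
Lemma is_derive_open_eq (R : realType) (D : set R) (f g : R -> R) (x df : R) :
  open D -> D x -> (forall y, D y -> f y = g y) ->
  is_derive x 1 f df -> is_derive x 1 g df.
Proof.
move=> oD Dx fg; apply: near_eq_is_derive.
by apply: filterS fg _; exact: open_nbhs_nbhs.
Qed.

Lemma derivable_n_is_derive (R : realType) (n k : nat) (D : set R)
    (f : R -> R) (x : R) :
  derivable_n n D f -> (k < n)%N -> D x -> is_derive x 1 f^`(k) (f^`(k.+1) x).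
Proof.
by move=> fD kn Dx; rewrite derive1nS derive1E; apply: derivableP; exact: fD.
Qed.

(** Cofactor expansion; since [j <= 2], the subtraction in [2 + i - j] never truncates. The
    polynomial form is what the product rule can be applied to. *)
Lemma det_toeplitz3 (R : comPzRingType) (g : nat -> R) :
  \det (\matrix_(i < 3, j < 3) g (2 + i - j)%N)
  = g 2 ^+ 3 + g 1 ^+ 2 * g 4 + g 0 * g 3 ^+ 2 - g 0 * g 2 * g 4
    - 2 * (g 1 * g 2 * g 3).
Proof.
rewrite (expand_det_row _ 0).
rewrite !big_ord_recl big_ord0 addr0 /cofactor !(expand_det_row _ 0).
rewrite !big_ord_recl !big_ord0 !addr0 /cofactor !det_mx11 !mxE /=.
rewrite /bump /=; ring.
Qed.

Section Solution.
(* [P k] and [F k] stand for the k-th derivatives of [p] and [f]; being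
   variables, they keep [ring] from unfolding iterated derivatives to limits. *)
Variables (R : realType) (D : set R) (P F : nat -> R -> R) (q : R).
Hypotheses (oD : open D)
  (dP : forall k x, (k < 4)%N -> D x -> is_derive x 1 (P k) (P k.+1 x))
  (FS : forall k, F k.+1 = (F k)^`())
  (dF : forall k x, (k < 2)%N -> D x -> is_derive x 1 (F k) (F k.+1 x))
  (eqF : forall x, D x -> F 2 x + P 0 x * F 1 x + q * F 0 x = 0).

Let derF k (x df : R) : is_derive x 1 (F k) df -> F k.+1 x = df.
Proof. by move=> Fdf; rewrite FS derive1E derive_val. Qed.

Lemma solution_derive2 x : D x -> F 2 x = - (P 0 x * F 1 x + q * F 0 x).
Proof. by move=> /eqF /eqP; rewrite -addrA addr_eq0 => /eqP. Qed.

(** Only two derivatives of the solution are assumed. The third exists because, on [D], the equation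
    equates [F 2] with a differentiable expression; the same bootstrap yields the higher orders. *)
Lemma solution_is_derive2 x : D x -> is_derive x 1 (F 2)
  (- (P 1 x * F 1 x + P 0 x * F 2 x + q * F 1 x)).
Proof.
move=> Dx; have dp0 := dP (k := 0) isT Dx.
have df0 := dF (k := 0) isT Dx; have df1 := dF (k := 1) isT Dx.
have dG := is_deriveN (is_deriveD (is_deriveM dp0 df1) (is_deriveZ q df0)).
apply: (is_derive_eq (is_derive_open_eq oD Dx _ dG)).
  by move=> y /solution_derive2 ->.
by rewrite /GRing.scale /=; ring.
Qed.

Lemma solution_derive3 x : D x ->
  F 3 x = - (P 1 x * F 1 x + P 0 x * F 2 x + q * F 1 x).
Proof. by move=> Dx; apply: derF; exact: solution_is_derive2. Qed.

Lemma solution_is_derive3 x : D x -> is_derive x 1 (F 3)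
  (- (P 2 x * F 1 x + 2 * (P 1 x * F 2 x) + P 0 x * F 3 x + q * F 2 x)).
Proof.
move=> Dx; have dp0 := dP (k := 0) isT Dx; have dp1 := dP (k := 1) isT Dx.
have df1 := dF (k := 1) isT Dx; have df2 := solution_is_derive2 Dx.
have dG := is_deriveN (is_deriveD
  (is_deriveD (is_deriveM dp1 df1) (is_deriveM dp0 df2)) (is_deriveZ q df1)).
apply: (is_derive_eq (is_derive_open_eq oD Dx _ dG)).
  by move=> y /solution_derive3 ->.
(* The derivative of [F 2] entered [dG] in expanded form, so [F 3 x] in the target is expanded to
   match. *)
by rewrite (solution_derive3 Dx) /GRing.scale /=; ring.
Qed.

Lemma solution_derive4 x : D x -> F 4 x =
  - (P 2 x * F 1 x + 2 * (P 1 x * F 2 x) + P 0 x * F 3 x + q * F 2 x).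
Proof. by move=> Dx; apply: derF; exact: solution_is_derive3. Qed.

(** The determinant contains [F 4], so its derivative requires the fifth derivative of the
    solution. *)
Lemma solution_is_derive4 x : D x -> is_derive x 1 (F 4)
  (- (P 3 x * F 1 x + 3 * P 2 x * F 2 x + 3 * P 1 x * F 3 x + P 0 x * F 4 x
      + q * F 3 x)).
Proof.
move=> Dx; have dp0 := dP (k := 0) isT Dx; have dp1 := dP (k := 1) isT Dx.
have dp2 := dP (k := 2) isT Dx; have df1 := dF (k := 1) isT Dx.
have df2 := solution_is_derive2 Dx; have df3 := solution_is_derive3 Dx.
have dG := is_deriveN (is_deriveD (is_deriveD (is_deriveD
  (is_deriveM dp2 df1) (is_deriveZ 2 (is_deriveM dp1 df2)))
  (is_deriveM dp0 df3)) (is_deriveZ q df2)).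
apply: (is_derive_eq (is_derive_open_eq oD Dx _ dG)).
  by move=> y /solution_derive4 ->.
rewrite (solution_derive4 Dx) (solution_derive3 Dx).
by rewrite /GRing.scale /=; ring.
Qed.

Let W x := \det (\matrix_(i < 3, j < 3) F (2 + i - j)%N x).

Let v x := F 1 x ^+ 2 - F 2 x * F 0 x.

Lemma solution_det_derive x : D x -> P 1 x != 0 ->
  derivable W x 1 /\
  W^`() x + 3 / 2 * (P 0 x - P 2 x / P 1 x) * W x
  = P 1 x * F 1 x *
    ((2^-1 * (P 1 x * P 0 x - P 2 x) * F 0 x + P 1 x * F 1 x) * F 1 x
     - (2^-1 * P 0 x ^+ 2 - P 1 x - 2 * q + P 3 x / P 1 x
        - 3 / 2 * (P 2 x ^+ 2 / P 1 x ^+ 2)) * v x).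
Proof.
move=> Dx p1x.
have df0 := dF (k := 0) isT Dx; have df1 := dF (k := 1) isT Dx.
have df2 := solution_is_derive2 Dx; have df3 := solution_is_derive3 Dx.
have df4 := solution_is_derive4 Dx.
(* The nesting follows the expanded determinant term by term, as written in [WE]. *)
have dW := is_deriveB (is_deriveB (is_deriveD (is_deriveD
  (is_deriveX 3 df2) (is_deriveM (is_deriveX 2 df1) df4))
  (is_deriveM df0 (is_deriveX 2 df3))) (is_deriveM (is_deriveM df0 df2) df4))
  (is_deriveZ 2 (is_deriveM (is_deriveM df1 df2) df3)).
have WE : W = F 2 ^+ 3 + F 1 ^+ 2 * F 4 + F 0 * F 3 ^+ 2 - F 0 * F 2 * F 4
              - 2 *: (F 1 * F 2 * F 3).
  by apply/funext => y; exact: det_toeplitz3 (F^~ y).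
rewrite derive1E WE; split; first exact: (@ex_derive _ _ _ _ _ _ _ dW).
rewrite (@derive_val _ _ _ _ _ _ _ dW) /v !fctE /GRing.scale /=.
(* Each formula involves lower orders, hence the descending order. What remains is rational in
   [F 0], [F 1], [P 0] to [P 3] and [q], with powers of [P 1 x] as denominators. *)
rewrite (solution_derive4 Dx) (solution_derive3 Dx) (solution_derive2 Dx).
by field.
Qed.

End Solution.

Theorem theorem17 (R : realType) (a b : \bar R) (p : R -> R) (q : R)
    (f : R -> R) (hp : class_C 4 (ooint a b) p)
    (hf : is_solution (ooint a b) p q f) :
  derivable_n 4 (ooint a b) f /\
  forall x : R, ooint a b x -> p^`() x != 0 ->
    derivable (wfun f) x 1 /\
    (wfun f)^`() x + 3 / 2 * (p x - p^`(2) x / p^`() x) * wfun f x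
      = p^`() x * f^`() x * Vfun p q f x.
Proof.
have oD := @open_ooint R a b.
pose P k := p^`(k); pose F k := f^`(k).
have dP k x : (k < 4)%N -> ooint a b x -> is_derive x 1 (P k) (P k.+1 x).
  exact: derivable_n_is_derive hp.1.
have dF k x : (k < 2)%N -> ooint a b x -> is_derive x 1 (F k) (F k.+1 x).
  exact: derivable_n_is_derive hf.1.
have FS k : F k.+1 = (F k)^`() by exact: derive1nS.
(* For these [P] and [F], the section's determinant and right-hand side are convertible to [wfun f]
   and the product with [Vfun p q f x]. *)
split; last by move=> x; exact: (solution_det_derive oD dP FS dF hf.2).
(* Orders 0 and 1 are part of being a solution; orders 2 and 3 come from the bootstrap. *)
move=> [|[|[|[|//]]]] x _ Dx; [exact: hf.1|exact: hf.1| |].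
- by have [] := solution_is_derive2 oD dP dF hf.2 Dx.
- by have [] := solution_is_derive3 oD dP FS dF hf.2 Dx.
Qed.
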